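(* Let $V$ and $W$ be normed vector spaces, and let $X\subset V$ and $Y\subset W$ be bounded subsets. Then the independent rectilinear join $XY$ is uniformly homeomorphic to the join $X*Y$.
   Context: For subsets $S,T$ of a vector space, $S\cdot T$ denotes the union of $S$, $T$ and all straight line segments with one endpoint in $S$ and the other in $T$. The independent rectilinear join of $X\subset V$ and $Y\subset W$ is $$XY=(X\times\{0\}\times\{-1\})\cdot(\{0\}\times Y\times\{1\})\subset V\times W\times\mathbb{R},$$ with the uniformity of a subspace of the normed space $V\times W\times\mathbb{R}$. The join $X*Y$ of uniform spaces is the pushout of $X\times Y\times[-1,1]\supset X\times Y\times\{-1,1\}\xrightarrow{\pi}X\sqcup Y$, where $\pi(x,y,-1)=x$ and $\pi(x,y,1)=y$; that is, the quotient of $(X\times Y\times[-1,1])\sqcup X\sqcup Y$ by the equivalence relation generated by $(x,y,-1)\sim x$ and $(x,y,1)\sim y$, endowed with the quotient uniformity (the finest pre-uniformity making the quotient map uniformly continuous). Here $X$ and $Y$ carry the uniformities induced from $V$ and $W$. *)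

(* Defs.v *)
From HB Require Import structures.
From mathcomp Require Import all_boot all_order all_algebra.
From mathcomp Require Import all_classical all_reals.
From mathcomp Require Import topology normedtype.
From Stdlib Require Import Relation_Operators.
Import Order.TTheory GRing.Theory Num.Theory numFieldNormedType.Exports.

Set Implicit Arguments.
Unset Strict Implicit.
Unset Printing Implicit Defensive.

Local Open Scope classical_set_scope.
Local Open Scope ring_scope.
Local Open Scope quotient_scope.

(* Disjoint union of uniform spaces: a relation is an entourage iff its restriction
   to each summand is one. *)
Section sum_uniform.
Local Open Scope relation_scope.
Variables X Y : uniformType.

Definition sum_ent : set_system ((X + Y) * (X + Y)) :=
  [set E | entourage [set xy : X * X | E (inl xy.1, inl xy.2)] /\
           entourage [set xy : Y * Y | E (inr xy.1, inr xy.2)]].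

Let sum_ent_filter : Filter sum_ent.
Proof.
split; first by split; exact: entourageT.
  move=> P Q [P1 P2] [Q1 Q2].
  by split; [exact: filterI P1 Q1|exact: filterI P2 Q2].
by move=> P Q PQ [P1 P2]; split; [apply: filterS P1|apply: filterS P2] => xy /PQ.
Qed.

Let sum_ent_diagonal E : sum_ent E -> diagonal `<=` E.
Proof.
move=> [E1 E2] [[x|y] _]/diagonalP<-.
  exact: (entourage_refl x E1).
exact: (entourage_refl y E2).
Qed.

Let sum_ent_inv E : sum_ent E -> sum_ent E^-1.
Proof.
by move=> [E1 E2]; split; [move/entourage_inv: E1|move/entourage_inv: E2].
Qed.

Let sum_ent_split E : sum_ent E -> exists2 B, sum_ent B & B \; B `<=` E.
Proof.
move=> [/entourage_split_ex[A eA AE] /entourage_split_ex[B eB BE]].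
exists [set uv | match uv.1, uv.2 with
  | inl x, inl x' => A (x, x') | inr y, inr y' => B (y, y') | _, _ => False end].
  by split; [apply: filterS eA => -[]|apply: filterS eB => -[]].
move=> [[x|y] [x'|y']] /= [[z|z]] //= h1 h2.
  by apply: (AE (x, x')); exists z.
by apply: (BE (y, y')); exists z.
Qed.

HB.instance Definition _ := isUniform.Build (X + Y)%type
  sum_ent_filter sum_ent_diagonal sum_ent_inv sum_ent_split.

End sum_uniform.

(* The finest uniformity on Q making pi uniformly continuous, as the supremum of
   all such uniformities; it need not be separated.  When pi is a quotient map,
   the topology it induces can differ from the quotient topology. *)
Section final_uniform.
Variables (T : uniformType) (Q : choiceType) (pi : T -> Q).

Definition final_uniform_family : Type :=
  {U : Uniform Q | @unif_continuous T (Uniform.Pack U) pi}.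

Definition final_uniform : Type :=
  sup_topology (fun U : final_uniform_family => sval U).

HB.instance Definition _ := Uniform.copy final_uniform
  (sup_topology (fun U : final_uniform_family => sval U)).

Lemma final_uniform_continuous : @unif_continuous T final_uniform pi.
Proof.
move=> A [B [F _ <-]] BA; apply: (filterS BA).
apply: filter_bigI => -[[U E] /= /asboolP UE] _.
exact: (svalP U) UE.
Qed.

Lemma final_uniform_finest (U : Uniform Q) :
  @unif_continuous T (Uniform.Pack U) pi ->
  @entourage (Uniform.Pack U) `<=` @entourage final_uniform.
Proof.
move=> piU E UE.
have UE' : `[< @entourage (Uniform.Pack U) E >] by apply/asboolP.
pose p : {p : {classic final_uniform_family} * set (Q * Q) |
    `[< @entourage (Uniform.Pack (sval p.1)) p.2 >]} :=
  exist _ (exist _ U piU, E) UE'.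
by exists E => //; exact: (@finI_from1 _ _ setT _ p I).
Qed.

End final_uniform.

Section generated_equivalence.
Variables (T : choiceType) (r : T -> T -> Prop).

Definition gen_equiv : rel T := fun x y => `[< clos_refl_sym_trans T r x y >].

Let gen_equiv_refl : reflexive gen_equiv.
Proof. by move=> x; apply/asboolP; exact: rst_refl. Qed.

Let gen_equiv_sym : symmetric gen_equiv.
Proof. by move=> x y; apply/asboolP/asboolP; exact: rst_sym. Qed.

Let gen_equiv_trans : transitive gen_equiv.
Proof.
move=> y x z /asboolP xy /asboolP yz.
by apply/asboolP; exact: rst_trans yz.
Qed.

Canonical gen_equiv_equiv :=
  EquivRel gen_equiv gen_equiv_refl gen_equiv_sym gen_equiv_trans.

End generated_equivalence.

Section join.
Variables (R : realType) (X Y : uniformType).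

Definition join_cylinder : uniformType :=
  (X * Y * set_type (`[-1, 1] : set R) + (X + Y))%type.

Inductive join_glue : join_cylinder -> join_cylinder -> Prop :=
| join_glue_l x y t : \val t = -1 ->
    join_glue (inl (x, y, t)) (inr (inl x))
| join_glue_r x y t : \val t = 1 ->
    join_glue (inl (x, y, t)) (inr (inr y)).

Definition join_quot := {eq_quot (gen_equiv_equiv join_glue)}.

Definition join : uniformType :=
  final_uniform (\pi_join_quot : join_cylinder -> join_quot).

End join.

Section rectilinear_join.
Context {R : realType}.

Definition dot_join {E : lmodType R} (S T : set E) : set E :=
  S `|` T `|`
  [set z | exists s t (a : R),
    [/\ S s, T t, 0 <= a <= 1 & z = (1 - a) *: s + a *: t]].

(* R^o is R seen as a normed space over itself; V * W * R^o carries the maximum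
   norm. *)
Definition indep_join {V W : normedModType R} (X : set V) (Y : set W) :
    set (V * W * R^o) :=
  dot_join (X `*` [set 0] `*` [set -1]) ([set 0] `*` Y `*` [set 1]).

End rectilinear_join.

Definition unif_homeomorphic (X Y : uniformType) : Prop :=
  exists (f : X -> Y) (g : Y -> X),
    [/\ cancel f g, cancel g f, unif_continuous f & unif_continuous g].

(* Main.v *)
Require Import Defs.
From mathcomp Require Import all_boot all_order all_algebra.
From mathcomp Require Import all_classical all_reals.
From mathcomp Require Import topology normedtype.
From mathcomp Require Import lra.
From Stdlib Require Import Relation_Operators.
Import Order.TTheory GRing.Theory Num.Theory numFieldNormedType.Exports.

Set Implicit Arguments.
Unset Strict Implicit.
Unset Printing Implicit Defensive.

Local Open Scope classical_set_scope.
Local Open Scope ring_scope.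
Local Open Scope quotient_scope.

(** Why the theorem is true.  The point at parameter [a] of the segment from
    [(x, 0, -1)] to [(0, y, 1)] has height [t = 2 a - 1], so it is
    [((1 - t)/2 x, (1 + t)/2 y, t)].  This formula defines a map [rect] on the
    disjoint union of the cylinder over [X] and [Y] with [X] and [Y] themselves.
    Its image is the rectilinear join ([rect_surj], [rect_indep_join]), and its
    fibres are exactly the classes of the gluing relation: the height is a
    coordinate of [rect], the point [x] can be recovered unless [t = 1], the point
    [y] unless [t = -1], and these are the parameters at which the gluing forgets
    them ([rect_inj_gen_equiv]).  So [rect] induces a bijection between the joins.

    From the join to the rectilinear join: the join carries the finest uniformity
    making the projection uniformly continuous, so it is enough that [rect]
    itself is uniformly continuous ([final_uniform_unif_continuous]).
    Multiplication of scalars by vectors is so on bounded sets only, which is the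
    first use of boundedness ([rect_unif_continuous]).

    From the rectilinear join to the join: a uniformly continuous map [p] on the
    disjoint union that respects the gluing must send representatives of close
    points of the rectilinear join to close points
    ([unif_continuous_descends_rect]).  Recovering [x] divides by [(1 - t)/2],
    which is not uniform as [t] approaches 1.  But near [t = 1] the exact value of
    [x] does not matter: by uniform continuity of [p] at the top of the
    cylinder, [p (x, y, t)] is close to [p (x, y, 1) = p y].  So fix a width [d]
    at which this collapse is controlled.  At height at most [1 - d/2] the
    divisor is bounded below and close images have close [x]; at height at least
    [-1 + d/2] they have close [y]; in the remaining two collars the comparison
    passes through the ends of the join.  The argument only composes entourages
    of the target of [p], so it applies to the quotient uniformity as it is, and
    no description of the entourages of the join is required. *)

(** * Maps out of a final uniformity and into a subspace *)

(** The uniformity that [h] pulls back from [Z] makes [p] uniformly continuous, so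
    it is coarser than the final one. *)
Lemma final_uniform_unif_continuous (T : uniformType) (Q : choiceType)
    (p : T -> Q) (Z : uniformType) (h : Q -> Z) :
  unif_continuous (h \o p) ->
  @unif_continuous (final_uniform p) Z h.
Proof.
move=> hpc A eA.
have pc : @unif_continuous T (Uniform.Pack (Uniform.class (initial_topology h))) p.
  move=> B [C eC CB].
  by apply: (@filterS _ (@entourage T) _ _ _ _ (hpc _ eC)) => xy; exact: (CB (_, _)).
have eB : initial_ent (f := h) [set xy | A (h xy.1, h xy.2)] by exists A.
exact: (@final_uniform_finest _ _ _ _ pc _ eB).
Qed.

Lemma gen_equiv_eq (T : choiceType) (r : T -> T -> Prop) (U : Type) (p : T -> U) :
  (forall c c', r c c' -> p c = p c') ->
  forall c c', gen_equiv r c c' -> p c = p c'.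
Proof.
move=> pr c c' /asboolP; elim=> {c c'} [c c'|//|c c' _ ->//|a b c _ -> _ ->//].
exact: pr.
Qed.

Lemma unif_continuous_set_type (T U : uniformType) (A : set U)
    (h : T -> set_type A) :
  unif_continuous (fun x => \val (h x)) -> unif_continuous h.
Proof.
move=> hc B [C eC CB].
by apply: (@filterS _ (@entourage T) _ _ _ _ (hc _ eC)) => xy; exact: (CB (_, _)).
Qed.

(** * Scaled vectors with close coefficients *)

Lemma ler_norm_sub_scale (R : numFieldType) (V : normedModType R)
    (a b : R) (x y : V) :
  `|a *: x - b *: y| <= `|a| * `|x - y| + `|a - b| * `|y|.
Proof.
rewrite -!normrZ (le_trans _ (ler_normD _ _))//.
by rewrite scalerBr scalerBl addrA subrK.
Qed.

Lemma ler_norm_sub_unscale (R : numFieldType) (V : normedModType R)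
    (a b : R) (x y : V) :
  `|a| * `|x - y| <= `|a *: x - b *: y| + `|a - b| * `|y|.
Proof.
rewrite -!normrZ -(opprB b a) scaleNr (normrN (_ *: y)).
rewrite (le_trans _ (ler_normD _ _))//.
by rewrite scalerBr scalerBl addrA subrK.
Qed.

(** The condition on [e] is the precision needed to recover a vector, up to [d],
    from its multiple by [a]; it degenerates as [a] approaches 0. *)
Lemma norm_sub_lt_unscale (R : realFieldType) (V : normedModType R)
    (a b e d M : R) (x y : V) :
  0 < a -> `|y| <= M -> e * (1 + M) <= a * d ->
  `|a *: x - b *: y| < e -> `|a - b| < e -> `|x - y| < d.
Proof.
move=> a0 yM ed xy ab; rewrite -(ltr_pM2l a0) -{1}(gtr0_norm a0).
apply: le_lt_trans (ler_norm_sub_unscale _ b _ _) _.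
have := normr_ge0 y; have := normr_ge0 (a - b); nra.
Qed.

Lemma bounded_set_norm_le (R : realFieldType) (V : normedModType R)
    (A : set V) :
  bounded_set A -> exists2 M : R, 0 <= M & forall x : set_type A, `|\val x| <= M.
Proof.
move=> [M [_ bM]]; exists (Num.max 0 (M + 1)); first by rewrite le_max lexx.
move=> x; apply: (bM _ _ (\val x)).
  by rewrite lt_max ltrDl ltr01 orbT.
exact: set_mem (svalP x).
Qed.

(** * The rectilinear parametrization of the join *)

Section join_of_subsets.
Variables (R : realType) (V W : normedModType R) (X : set V) (Y : set W).
Local Notation cyl := (join_cylinder R (set_type X) (set_type Y)).
Local Notation itv := (set_type (`[-1, 1]%classic : set R)).

Lemma itv_bound (t : itv) : -1 <= \val t <= 1.
Proof. by have := set_mem (svalP t); rewrite /= in_itv. Qed.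

Lemma itvN1_subproof : (-1 : R) \in (`[-1, 1]%classic : set R).
Proof. by apply: mem_set; rewrite /= in_itv /= lexx/=; lra. Qed.

Lemma itv1_subproof : (1 : R) \in (`[-1, 1]%classic : set R).
Proof. by apply: mem_set; rewrite /= in_itv /= lexx andbT; lra. Qed.

Definition itvN1 : itv := exist _ (-1) itvN1_subproof.
Definition itv1 : itv := exist _ 1 itv1_subproof.

(** The parametrization before gluing: the last two clauses are the values that the
    first one takes at [t = -1] and at [t = 1]. *)
Definition rect (c : cyl) : V * W * R^o :=
  match c with
  | inl (x, y, t) =>
      (((1 - \val t) / 2) *: \val x, ((1 + \val t) / 2) *: \val y, \val t)
  | inr (inl x) => (\val x, 0, -1)
  | inr (inr y) => (0, \val y, 1)
  end.

Lemma rect_glue (c c' : cyl) : join_glue c c' -> rect c = rect c'.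
Proof.
case=> x y t /= ->.
- have -> : (1 - -1) / 2 = 1 :> R by lra.
  by rewrite subrr mul0r scale0r scale1r.
- have -> : (1 + 1) / 2 = 1 :> R by lra.
  by rewrite subrr mul0r scale0r scale1r.
Qed.

Lemma rect_height (c : cyl) : -1 <= (rect c).2 <= 1.
Proof. by case: c => [[[x y] t]|[x|y]] /=; [exact: itv_bound|lra|lra]. Qed.

Lemma rect_indep_join (c : cyl) : indep_join X Y (rect c).
Proof.
case: c => [[[x y] t]|[x|y]] /=.
- right; exists (\val x, 0, -1), (0, \val y, 1), ((1 + \val t) / 2).
  have t1 := itv_bound t; split.
  + by split => //; split => //; exact: (set_mem (svalP x)).
  + by split => //; split => //; exact: (set_mem (svalP y)).
  + lra.
  + have -> : 1 - (1 + \val t) / 2 = (1 - \val t) / 2 by lra.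
    apply: injective_projections => /=; last first.
      by rewrite /GRing.scale /=; lra.
    by apply: injective_projections; rewrite /= scaler0 ?addr0 ?add0r.
- left; left; split => //; split => //; exact: (set_mem (svalP x)).
- left; right; split => //; split => //; exact: (set_mem (svalP y)).
Qed.

Lemma rect_surj (z : V * W * R^o) : indep_join X Y z -> exists c, rect c = z.
Proof.
case: z => -[v w] h [[|]|].
- move=> [[/= Xv ->] ->]; exists (inr (inl (exist _ v (mem_set Xv)))) => //.
- move=> [[/= -> Yw] ->]; exists (inr (inr (exist _ w (mem_set Yw)))) => //.
move=> [[[x o] m] [[[o' y] m'] [a [[[/= Xx ->] ->] [[/= -> Yy] ->]]]]].
move=> a01 [-> -> ->].
have ta : 2 * a - 1 \in (`[-1, 1]%classic : set R).
  by apply: mem_set; rewrite /= in_itv /=; lra.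
pose t : itv := exist _ (2 * a - 1) ta.
exists (inl (exist _ x (mem_set Xx), exist _ y (mem_set Yy), t)) => /=.
rewrite !scaler0 addr0 add0r; apply: injective_projections => /=; last first.
  by rewrite /GRing.scale /=; lra.
by congr (_ *: _, _ *: _); lra.
Qed.

(** The feet of [c] are the end points of the segment that carries it.  They are
    given by relations because a point of [X] or [Y] lies on no segment in
    particular, and on none at all when the other set is empty. *)
Definition left_foot (c : cyl) (x : set_type X) : Prop :=
  match c with
  | inl (x', _, _) | inr (inl x') => x' = x
  | inr (inr _) => False
  end.

Definition right_foot (c : cyl) (y : set_type Y) : Prop :=
  match c with
  | inl (_, y', _) | inr (inr y') => y' = y
  | inr (inl _) => False
  end.

Lemma rect_left (c : cyl) : (rect c).2 < 1 -> exists2 x : set_type X,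
  left_foot c x & (rect c).1.1 = ((1 - (rect c).2) / 2) *: \val x.
Proof.
case: c => [[[x y] t]|[x|y]] /= ct; [by exists x| |by rewrite ltxx in ct].
exists x => //; have -> : (1 - -1) / 2 = 1 :> R by lra.
by rewrite scale1r.
Qed.

Lemma rect_right (c : cyl) : -1 < (rect c).2 -> exists2 y : set_type Y,
  right_foot c y & (rect c).1.2 = ((1 + (rect c).2) / 2) *: \val y.
Proof.
case: c => [[[x y] t]|[x|y]] /= ct; [by exists y|by rewrite ltxx in ct|].
exists y => //; have -> : (1 + 1) / 2 = 1 :> R by lra.
by rewrite scale1r.
Qed.

Lemma two_feet (c : cyl) x y : left_foot c x -> right_foot c y ->
  exists2 t, c = inl (x, y, t) & \val t = (rect c).2.
Proof. by case: c => [[[x' y'] t]|[x'|y']] //= -> ->; exists t. Qed.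

Lemma gen_equiv_left (c : cyl) x : left_foot c x -> (rect c).2 = -1 ->
  gen_equiv (@join_glue _ _ _) c (inr (inl x)).
Proof.
case: c => [[[x' y] t]|[x'|y]] //= -> t1; apply/asboolP; last exact: rst_refl.
by apply: rst_step; constructor.
Qed.

Lemma gen_equiv_right (c : cyl) y : right_foot c y -> (rect c).2 = 1 ->
  gen_equiv (@join_glue _ _ _) c (inr (inr y)).
Proof.
case: c => [[[x y'] t]|[x|y']] //= -> t1; apply/asboolP; last exact: rst_refl.
by apply: rst_step; constructor.
Qed.

(** Below height 1 the value of [rect] determines the left foot, above height -1 it
    determines the right foot.  A point strictly in between is determined by both
    feet and the height, and at either end the class is that of one foot. *)
Lemma rect_inj_gen_equiv (c c' : cyl) :
  rect c = rect c' -> gen_equiv (@join_glue _ _ _) c c'.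
Proof.
move=> cc'.
have left_eq : (rect c).2 < 1 -> exists2 x, left_foot c x & left_foot c' x.
  move=> h1; have [x cx xc] := rect_left h1.
  have [|x' cx' xc'] := @rect_left c'; first by rewrite -cc'.
  suff xx' : x = x' by exists x => //; rewrite xx'.
  apply: val_inj; move: xc; rewrite cc' xc' => /scalerI ->//.
  by rewrite gt_eqF// -cc'; lra.
have right_eq : -1 < (rect c).2 -> exists2 y, right_foot c y & right_foot c' y.
  move=> h1; have [y cy yc] := rect_right h1.
  have [|y' cy' yc'] := @rect_right c'; first by rewrite -cc'.
  suff yy' : y = y' by exists y => //; rewrite yy'.
  apply: val_inj; move: yc; rewrite cc' yc' => /scalerI ->//.
  by rewrite gt_eqF// -cc'; lra.
have /andP[] := rect_height c; rewrite le_eqVlt => /orP[/eqP/esym c1 _|cN1].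
  have [|x cx cx'] := left_eq; first by rewrite c1; lra.
  apply/asboolP; apply: rst_trans (asboolW (gen_equiv_left cx c1)) _.
  by apply: rst_sym; apply: asboolW; apply: gen_equiv_left; rewrite // -cc'.
rewrite le_eqVlt => /orP[/eqP c1|c1].
  have [|y cy cy'] := right_eq; first by rewrite c1; lra.
  apply/asboolP; apply: rst_trans (asboolW (gen_equiv_right cy c1)) _.
  by apply: rst_sym; apply: asboolW; apply: gen_equiv_right; rewrite // -cc'.
have [x cx cx'] := left_eq c1; have [y cy cy'] := right_eq cN1.
have [t cE tE] := two_feet cx cy; have [t' cE' tE'] := two_feet cx' cy'.
have -> : c = c'.
  by rewrite cE cE'; do 2 f_equal; apply: val_inj; rewrite tE tE' cc'.
by apply/asboolP; exact: rst_refl.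
Qed.

(** * Uniform continuity of the parametrization *)

(** Taking one radius for the three summands turns uniform continuity on the
    disjoint union into an epsilon-delta condition. *)
Lemma cyl_entourageP (E : set (cyl * cyl)) : entourage E <->
  exists2 d : R, 0 < d &
    [/\ forall x y t x' y' t', `|\val x - \val x'| < d ->
          `|\val y - \val y'| < d -> `|\val t - \val t'| < d ->
          E (inl (x, y, t), inl (x', y', t')),
        forall x x', `|\val x - \val x'| < d ->
          E (inr (inl x), inr (inl x')) &
        forall y y', `|\val y - \val y'| < d ->
          E (inr (inr y), inr (inr y'))].
Proof.
split=> [[+ [+ +]]|[d d0 [d1 d2 d3]]].
  rewrite -!entourage_ballE => -[a /= a0 Ea] [b /= b0 Eb] [c /= c0 Ec].
  exists (Num.min a (Num.min b c)); first by rewrite !lt_min a0 b0 c0.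
  split=> [x y t x' y' t'|x x'|y y']; rewrite !lt_min.
  - move=> /andP[hx _] /andP[hy _] /andP[ht _].
    apply: (Ea (x, y, t, (x', y', t'))); split; first split => /=.
    + by rewrite -initial_ballE /preimage /= -ball_normE.
    + by rewrite -initial_ballE /preimage /= -ball_normE.
    + by rewrite -initial_ballE /preimage /= -ball_normE.
  - move=> /and3P[_ hx _]; apply: (Eb (x, x')).
    by rewrite /= -initial_ballE /preimage /= -ball_normE.
  - move=> /and3P[_ _ hy]; apply: (Ec (y, y')).
    by rewrite /= -initial_ballE /preimage /= -ball_normE.
split; [|split]; rewrite -entourage_ballE; exists d => //=.
- move=> [[[x y] t] [[x' y'] t']] [[/= hx hy] ht].
  by apply: d1; [move: hx|move: hy|move: ht];
     rewrite -initial_ballE /preimage /= -ball_normE.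
- move=> [x x'] /=; rewrite -initial_ballE /preimage /= -ball_normE; exact: d2.
- move=> [x x'] /=; rewrite -initial_ballE /preimage /= -ball_normE; exact: d3.
Qed.

(** The delta is [e / (1 + M + N)], with [M] and [N] bounds for [X] and [Y]: the
    coefficients [(1 - t)/2] and [(1 + t)/2] are at most 1 and Lipschitz in [t], and
    their variation is multiplied by vectors of norm at most [M] and [N]. *)
Lemma rect_unif_continuous (bX : bounded_set X) (bY : bounded_set Y) :
  unif_continuous rect.
Proof.
have [M M0 XM] := bounded_set_norm_le bX.
have [N N0 YN] := bounded_set_norm_le bY.
move=> A entA.
have [e /= e0 eA] : entourage_ (@ball R (V * W * R^o)%type) A.
  by rewrite entourage_ballE.
apply/cyl_entourageP.
have K0 : 0 < 1 + M + N by lra.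
exists (e / (1 + M + N)); first by rewrite divr_gt0.
have {K0} := divfK (lt0r_neq0 K0) e; set d := e / _ => dE.
have d0 : 0 < d by rewrite divr_gt0//; lra.
split=> [x y t x' y' t' hx hy ht|x x' hx|y y' hy]; apply: eA => /=.
- have t1 := itv_bound t; split; first split; rewrite -ball_normE /=.
  + apply: le_lt_trans (ler_norm_sub_scale _ _ _ _) _.
    have := XM x'; have := normr_ge0 (\val x').
    have := normr_ge0 (\val x - \val x').
    have -> : (1 - \val t) / 2 - (1 - \val t') / 2 = - ((\val t - \val t') / 2) by lra.
    rewrite normrN (ger0_norm (_ : 0 <= (1 - \val t) / 2)); last lra.
    rewrite normrM (ger0_norm (_ : 0 <= 2^-1)); last lra.
    nra.
  + apply: le_lt_trans (ler_norm_sub_scale _ _ _ _) _.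
    have := YN y'; have := normr_ge0 (\val y').
    have := normr_ge0 (\val y - \val y').
    have -> : (1 + \val t) / 2 - (1 + \val t') / 2 = ((\val t - \val t') / 2) by lra.
    rewrite (ger0_norm (_ : 0 <= (1 + \val t) / 2)); last lra.
    rewrite normrM (ger0_norm (_ : 0 <= 2^-1)); last lra.
    nra.
  + by apply: lt_le_trans ht _; nra.
- split; first split; rewrite -ball_normE /= ?subrr ?normr0 //.
  by apply: lt_le_trans hx _; nra.
- split; first split; rewrite -ball_normE /= ?subrr ?normr0 //.
  by apply: lt_le_trans hy _; nra.
Qed.

(** * Uniform continuity of the inverse *)

(** Away from the right end the left foot depends uniformly on the image.  At
    height at most [1 - d/2] the coefficient [(1 - t)/2] is at least [d/4], which is
    why [e (1 + M)] is compared with [d * d / 4].  The bound [e <= d/2] keeps the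
    second point strictly below height 1, so that it has a left foot too. *)
Lemma left_feet_close (M e d : R) (c c' : cyl) :
  (forall x : set_type X, `|\val x| <= M) -> 0 < d <= 1 -> e <= d / 2 ->
  e * (1 + M) <= d * d / 4 -> ball (rect c) e (rect c') ->
  (rect c).2 <= 1 - d / 2 -> exists x x',
    [/\ left_foot c x, left_foot c' x' & `|\val x - \val x'| < d].
Proof.
move=> XM /andP[d0 d1] ed eM [[+ _]]; rewrite -!ball_normE /= => hv ht td.
move: (ht); rewrite ltr_norml => /andP[ht1 ht2].
have [|x cx xc] := @rect_left c; first by lra.
have [|x' cx' xc'] := @rect_left c'; first by lra.
exists x, x'; split => //; move: hv; rewrite xc xc' => hv.
apply: norm_sub_lt_unscale (XM x') _ hv _ => {XM}.
- by lra.
- by nra.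
- by rewrite ltr_norml; lra.
Qed.

Lemma right_feet_close (N e d : R) (c c' : cyl) :
  (forall y : set_type Y, `|\val y| <= N) -> 0 < d <= 1 -> e <= d / 2 ->
  e * (1 + N) <= d * d / 4 -> ball (rect c) e (rect c') ->
  -1 + d / 2 <= (rect c).2 -> exists y y',
    [/\ right_foot c y, right_foot c' y' & `|\val y - \val y'| < d].
Proof.
move=> YN /andP[d0 d1] ed eN [[_ +]]; rewrite -!ball_normE /= => hw ht td.
move: (ht); rewrite ltr_norml => /andP[ht1 ht2].
have [|y cy yc] := @rect_right c; first by lra.
have [|y' cy' yc'] := @rect_right c'; first by lra.
exists y, y'; split => //; move: hw; rewrite yc yc' => hw.
apply: norm_sub_lt_unscale (YN y') _ hw _ => {YN}.
- by lra.
- by nra.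
- by rewrite ltr_norml; lra.
Qed.

(** A point in the left collar of width [d] is either a left end point or, along
    its own segment, within [d] of a cylinder point that is glued to one. *)
Lemma glue_left_foot (d : R) (c : cyl) x : left_foot c x ->
  (rect c).2 < -1 + d -> c = inr (inl x) \/ exists y t,
    [/\ c = inl (x, y, t), join_glue (inl (x, y, itvN1)) (inr (inl x)) &
        `|\val t - \val itvN1| < d].
Proof.
have := rect_height c; case: c => [[[x' y] t]|[x'|y]] //= ht ->{x'} td; last by left.
right; exists y, t; split=> //; first by constructor.
by rewrite ltr_norml; lra.
Qed.

Lemma glue_right_foot (d : R) (c : cyl) y : right_foot c y ->
  1 - d < (rect c).2 -> c = inr (inr y) \/ exists x t,
    [/\ c = inl (x, y, t), join_glue (inl (x, y, itv1)) (inr (inr y)) &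
        `|\val t - \val itv1| < d].
Proof.
have := rect_height c; case: c => [[[x y'] t]|[x|y']] //= ht ->{y'} td; last by left.
right; exists x, t; split=> //; first by constructor.
by rewrite ltr_norml; lra.
Qed.

(** The two scales of the argument: [d] is the width of the collars in which the
    segments are collapsed to their ends, and [e], quadratic in [d], is the
    precision needed to recover the feet outside the opposite collar. *)
Lemma collapse_scales_ex (M N d0 : R) : 0 <= M -> 0 <= N -> 0 < d0 ->
  exists d e : R, [/\ 0 < d <= 1, d <= d0, 0 < e <= d / 2,
    e * (1 + M) <= d * d / 4 & e * (1 + N) <= d * d / 4].
Proof.
move=> M0 N0 d00.
have d_gt0 : 0 < Num.min d0 1 by rewrite lt_min d00 ltr01.
exists (Num.min d0 1).
have dd0 : Num.min d0 1 <= d0 by rewrite ge_min lexx.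
have : Num.min d0 1 <= 1 by rewrite ge_min lexx orbT.
move: (Num.min d0 1) d_gt0 dd0 => d d_gt0 dd0 d1.
have K0 : 0 < 1 + M + N by lra.
exists (d * d / 4 / (1 + M + N)).
have : 0 < d * d / 4 / (1 + M + N) by rewrite !divr_gt0// mulr_gt0.
have := divfK (lt0r_neq0 K0) (d * d / 4).
by move: (_ / (1 + M + N)) => e eE e0; split; nra.
Qed.

(** Two close points in the left collar are compared through their left feet, which
    takes a composition of three entourages; the right collar is symmetric, and in
    the middle both feet and the heights are close. *)
Lemma unif_continuous_descends_rect (Z : uniformType) (p : cyl -> Z) :
  bounded_set X -> bounded_set Y -> unif_continuous p ->
  (forall c c', join_glue c c' -> p c = p c') ->
  forall E, entourage E -> exists2 e : R, 0 < e &
    forall c c', ball (rect c) e (rect c') -> E (p c, p c').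
Proof.
move=> /bounded_set_norm_le[M M0 XM] /bounded_set_norm_le[N N0 YN] pc pg E entE.
set D := split_ent (split_ent E).
have entD : entourage D by exact/entourage_split_ent/entourage_split_ent.
have DE a b c d : D (a, b) -> D (b, c) -> D (c, d) -> E (a, d).
  move=> ab bc cd.
  apply: (entourage_split b) => //; last exact: (entourage_split c).
  by apply: (entourage_split b) => //; exact: entourage_refl.
have DF a b : D (a, b) -> E (a, b).
  by move=> ab; apply: (DE _ a b b) => //; exact: entourage_refl.
have /cyl_entourageP[d0 d00 [Dcyl DX DY]] :
  entourage [set cc : cyl * cyl | D (p cc.1, p cc.2)] by exact: pc.
have [d [e [d01 dd0 /andP[e0 ed] eM eN]]] := collapse_scales_ex M0 N0 d00.
exists e => // c c' cc'.
have [_ ht] := cc'; rewrite -!ball_normE /= in ht.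
have close (U : normedModType R) (u v : U) : `|u - v| < d -> `|u - v| < d0.
  by move=> /lt_le_trans; exact.
have collapse_left a x : left_foot a x -> (rect a).2 < -1 + d ->
    D (p a, p (inr (inl x))) /\ D (p (inr (inl x)), p a).
  move=> ax /(glue_left_foot ax)[->|[y [t [-> /pg <- td]]]].
    by split; exact: entourage_refl.
  by split; apply: Dcyl; rewrite ?subrr ?normr0//; apply: close => //; rewrite distrC.
have collapse_right a y : right_foot a y -> 1 - d < (rect a).2 ->
    D (p a, p (inr (inr y))) /\ D (p (inr (inr y)), p a).
  move=> ay /(glue_right_foot ay)[->|[x [t [-> /pg <- td]]]].
    by split; exact: entourage_refl.
  by split; apply: Dcyl; rewrite ?subrr ?normr0//; apply: close => //; rewrite distrC.
have left_close := left_feet_close XM d01 ed eM cc'.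
have right_close := right_feet_close YN d01 ed eN cc'.
(* The half width d / 2 + e <= d keeps the second point in the collar as well. *)
have [tl|tl] := ltP (rect c).2 (-1 + d / 2).
  have [tl1 tl' tl2] : [/\ (rect c).2 < -1 + d, (rect c').2 < -1 + d &
      (rect c).2 <= 1 - d / 2].
    move: d01 tl ht ed; rewrite ltr_norml; clear; split; lra.
  have [x [x' [cx cx' /close xx']]] := left_close tl2.
  have [cx1 _] := collapse_left _ _ cx tl1.
  have [_ cx1'] := collapse_left _ _ cx' tl'.
  exact: DE cx1 (DX _ _ xx') cx1'.
have [tr|tr] := ltP (1 - d / 2) (rect c).2.
  have [tr1 tr'] : 1 - d < (rect c).2 /\ 1 - d < (rect c').2.
    move: d01 tr ht ed; rewrite ltr_norml; clear; split; lra.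
  have [y [y' [cy cy' /close yy']]] := right_close tl.
  have [cy1 _] := collapse_right _ _ cy tr1.
  have [_ cy1'] := collapse_right _ _ cy' tr'.
  exact: DE cy1 (DY _ _ yy') cy1'.
have [x [x' [cx cx' /close xx']]] := left_close tr.
have [y [y' [cy cy' /close yy']]] := right_close tl.
have [t cE tE] := two_feet cx cy; have [t' cE' tE'] := two_feet cx' cy'.
apply: DF; rewrite cE cE'; apply: Dcyl => //.
rewrite tE tE'; apply: lt_le_trans ht _.
by move: d01 ed dd0; clear; lra.
Qed.

End join_of_subsets.

Theorem theorem11p9 (R : realType) (V W : normedModType R)
  (X : set V) (Y : set W) (bX : bounded_set X) (bY : bounded_set Y) :
  unif_homeomorphic (set_type (indep_join X Y))
    (join R (set_type X) (set_type Y)).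
Proof.
pose cyl := join_cylinder R (set_type X) (set_type Y).
pose pi : cyl -> join R (set_type X) (set_type Y) :=
  \pi_(join_quot R (set_type X) (set_type Y)).
have piE (c c' : cyl) : rect c = rect c' -> pi c = pi c'.
  by move=> cc'; apply/eqquotP; exact: rect_inj_gen_equiv.
have pi_glue (c c' : cyl) : join_glue c c' -> pi c = pi c'.
  by move=> /rect_glue; exact: piE.
have piP (c c' : cyl) : pi c = pi c' -> rect c = rect c'.
  by move=> /eqquotP; apply: gen_equiv_eq; exact: rect_glue.
have sec (z : set_type (indep_join X Y)) : {c : cyl | rect c = \val z}.
  by apply: cid; apply: rect_surj; exact: set_mem (svalP z).
pose f (z : set_type (indep_join X Y)) := pi (sval (sec z)).
pose g (q : join R (set_type X) (set_type Y)) : set_type (indep_join X Y) :=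
  exist _ (rect (repr (q : join_quot _ _ _))) (mem_set (rect_indep_join _)).
have reprpi (c : cyl) : rect (repr (pi c : join_quot _ _ _)) = rect c.
  by apply: piP; exact: reprK.
have pi_uc : unif_continuous pi by exact: final_uniform_continuous.
exists f, g; split.
- by move=> z; apply: val_inj; rewrite /= reprpi (svalP (sec z)).
- move=> q; rewrite /f -[RHS](reprK (q : join_quot _ _ _)); apply: piE.
  by rewrite (svalP (sec (g q))).
- move=> E entE.
  have [e e0 eE] := @unif_continuous_descends_rect _ _ _ _ _ _ pi bX bY pi_uc pi_glue E entE.
  exists [set zz | ball zz.1 e zz.2]; first by rewrite -entourage_ballE; exists e.
  move=> [z z'] /= zz'; apply: eE.
  by rewrite (svalP (sec z)) (svalP (sec z')).
- apply: final_uniform_unif_continuous; apply: unif_continuous_set_type.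
  have -> : (fun c => \val ((g \o pi) c)) = @rect R V W X Y.
    by apply/funext => c /=; rewrite reprpi.
  exact: rect_unif_continuous.
Qed.
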